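(* There is a translation surface $S$ for which $\mathrm{Iso}(J(S))\neq \mathrm{Aff}^+(H_1(S,\mathbb{Q}),\omega)$.
   Context: A translation surface is a compact (connected, oriented) surface $S$ obtained by gluing finitely many polygons in $\mathbb{R}^2$ along parallel edges by translations. View $\mathbb{R}^2$ as a $\mathbb{Q}$-vector space. Take an edge-to-edge decomposition of $S$ into Euclidean triangles $\Delta_j$ whose vertex set contains the singular points, and let $v_j,w_j\in\mathbb{R}^2$ be two successive sides of $\Delta_j$ in counterclockwise order. The $J$-invariant is $J(S)=\sum_j v_j\wedge w_j\in\mathbb{R}^2\wedge_{\mathbb{Q}}\mathbb{R}^2$ (independent of the triangulation). $\mathrm{Iso}(J(S))$ is the group of $\alpha\in SL(2,\mathbb{R})$ that fix $J(S)$ under the induced action $v\wedge w\mapsto \alpha v\wedge\alpha w$. The homological affine group $\mathrm{Aff}^+(H_1(S,\mathbb{Q}),\omega)$ is the group of matrices $\alpha\in SL(2,\mathbb{R})$ for which there is an automorphism $A$ of $H_1(S;\mathbb{Q})$ that preserves the intersection pairing and satisfies $\mathrm{hol}\circ A=\alpha\circ\mathrm{hol}$, where $\mathrm{hol}:H_1(S;\mathbb{Q})\to\mathbb{R}^2$ is $\sigma\mapsto(\int_\sigma dx,\int_\sigma dy)$. *)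

(* Defs.v *)
From HB Require Import structures.
From mathcomp Require Import all_boot all_order all_algebra.
From mathcomp Require Import boolp classical_sets reals.
From mathcomp Require Import finmap ring.
From mathcomp.multinomials Require Import monalg.

Set Implicit Arguments.
Unset Strict Implicit.
Unset Printing Implicit Defensive.

Import Order.TTheory GRing.Theory Num.Theory.

Local Open Scope ring_scope.
Local Open Scope quotient_scope.
Local Open Scope classical_set_scope.

Section LinearSpan.
Variables (K : fieldType) (V : lmodType K).

Definition lspan (X : set V) : V -> bool := fun v =>
  `[< forall W : submodClosed V, (forall x, X x -> x \in W) -> v \in W >].

Lemma lspan_submod_closed X : submod_closed (lspan X).
Proof.
split=> [|a u v /asboolP Xu /asboolP Xv]; apply/asboolP => W XW.
  exact: rpred0.
by rewrite rpredD ?rpredZ ?Xu ?Xv.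
Qed.
HB.instance Definition _ X :=
  GRing.isSubmodClosed.Build K V (lspan X) (lspan_submod_closed X).

Lemma lspan_mem (X : set V) x : X x -> x \in lspan X.
Proof. by move=> Xx; apply/asboolP => W; apply. Qed.

Lemma lspan_min (X : set V) (W : submodClosed V) :
  (forall x, X x -> x \in W) -> {subset lspan X <= W}.
Proof. by move=> XW v /asboolP; apply. Qed.

End LinearSpan.

(* The quotient of V by the subspace spanned by X: the additive quotient of
   ring_quotient, with the induced scalar multiplication. *)
Definition lquot (K : fieldType) (V : lmodType K) (X : set V) : Type :=
  Quotient.quot (GRing.ZmodClosed.clone V (lspan X) _).

Section LinearQuotient.
Variables (K : fieldType) (V : lmodType K) (X : set V).

HB.instance Definition _ := GRing.Zmodule.on (lquot X).

Definition lclass (v : V) : lquot X :=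
  \pi_(Quotient.quot (GRing.ZmodClosed.clone V (lspan X) _)) v.
Definition lrepr (x : lquot X) : V :=
  repr (x : Quotient.quot (GRing.ZmodClosed.clone V (lspan X) _)).

Lemma lreprK x : lclass (lrepr x) = x.
Proof. exact: reprK. Qed.

Lemma lclassP u v : reflect (lclass u = lclass v) (u - v \in lspan X).
Proof.
suff -> : (u - v \in lspan X) = (lclass u == lclass v) by exact: eqP.
by rewrite /lclass -Quotient.idealrBE.
Qed.

Lemma lrepr_class v : lrepr (lclass v) - v \in lspan X.
Proof. by apply/lclassP; rewrite lreprK. Qed.

Fact lclass_is_zmod_morphism : zmod_morphism lclass.
Proof. by move=> u v; rewrite /lclass !piE. Qed.
HB.instance Definition _ :=
  GRing.isZmodMorphism.Build V (lquot X) lclass lclass_is_zmod_morphism.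

Definition lquot_scale (a : K) (x : lquot X) : lquot X := lclass (a *: lrepr x).

Lemma lquot_scaleE a v : lquot_scale a (lclass v) = lclass (a *: v).
Proof. by apply/lclassP; rewrite -scalerBr rpredZ ?lrepr_class. Qed.

Fact lquot_scaleA a b x :
  lquot_scale a (lquot_scale b x) = lquot_scale (a * b) x.
Proof. by rewrite -[x]lreprK !lquot_scaleE scalerA. Qed.
Fact lquot_scale1 : left_id 1 lquot_scale.
Proof. by move=> x; rewrite -[x]lreprK lquot_scaleE scale1r. Qed.
Fact lquot_scaleDr : right_distributive lquot_scale +%R.
Proof.
move=> a x y; rewrite -[x]lreprK -[y]lreprK -raddfD !lquot_scaleE.
by rewrite scalerDr raddfD.
Qed.
Fact lquot_scaleDl x : {morph lquot_scale^~ x : a b / a + b}.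
Proof. by move=> a b; rewrite -[x]lreprK !lquot_scaleE scalerDl raddfD. Qed.

HB.instance Definition _ := GRing.Zmodule_isLmodule.Build K (lquot X)
  lquot_scaleA lquot_scale1 lquot_scaleDr lquot_scaleDl.

Fact lclass_is_scalable : scalable lclass.
Proof. by move=> a v; rewrite -lquot_scaleE. Qed.
HB.instance Definition _ :=
  GRing.isScalable.Build K V (lquot X) *:%R lclass lclass_is_scalable.

(* The map induced on the quotient by f; only meaningful when f kills X. *)
Definition lquot_lift (W : Type) (f : V -> W) (x : lquot X) : W := f (lrepr x).

Lemma lquot_liftE (W : lmodType K) (f : {linear V -> W}) v :
  (forall x, X x -> f x = 0) -> lquot_lift f (lclass v) = f v.
Proof.
move=> fX; apply/eqP; rewrite -subr_eq0 -raddfB; apply/eqP.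
move: (lrepr_class v) => /asboolP.
pose kf : V -> bool := fun u => f u == 0.
have kf_closed : submod_closed kf.
  split=> [|a u w]; rewrite /kf !unfold_in ?raddf0 // => /eqP fu /eqP fw.
  by rewrite linearP fu fw scaler0 addr0.
pose kfM := GRing.isSubmodClosed.Build K V kf kf_closed.
pose kfS : submodClosed V := HB.pack kf kfM.
by move/(_ kfS (fun x Xx => introT eqP (fX x Xx)))/eqP.
Qed.

End LinearQuotient.

(* The exterior square of V over K: the free K-module on V * V modulo
   bilinearity and v /\ v = 0. *)
Section ExteriorSquare.
Variables (K : fieldType) (V : lmodType K).

Definition ext2_gen (v w : V) : {malg K[(V * V)%type]} := << (v, w) >>.

Inductive ext2_rel : set {malg K[(V * V)%type]} :=
| Ext2Linl a u v w :
    ext2_rel (ext2_gen (a *: u + v) w - (a *: ext2_gen u w + ext2_gen v w))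
| Ext2Linr a u v w :
    ext2_rel (ext2_gen u (a *: v + w) - (a *: ext2_gen u v + ext2_gen u w))
| Ext2Alt v : ext2_rel (ext2_gen v v).

Definition ext2 : Type := lquot ext2_rel.
HB.instance Definition _ := GRing.Lmodule.on ext2.

Definition wedge (v w : V) : ext2 := lclass ext2_rel (ext2_gen v w).

Lemma wedgePl a u v w : wedge (a *: u + v) w = a *: wedge u w + wedge v w.
Proof.
rewrite /wedge -linearP; apply/lclassP; apply: lspan_mem; exact: Ext2Linl.
Qed.

Lemma wedgePr a u v w : wedge u (a *: v + w) = a *: wedge u v + wedge u w.
Proof.
rewrite /wedge -linearP; apply/lclassP; apply: lspan_mem; exact: Ext2Linr.
Qed.

Lemma wedgevv v : wedge v v = 0.
Proof.
rewrite /wedge -[RHS](raddf0 (lclass ext2_rel)); apply/lclassP.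
rewrite subr0; apply: lspan_mem; exact: Ext2Alt.
Qed.

End ExteriorSquare.

Section ExteriorSquareMap.
Variables (K : fieldType) (V W : lmodType K) (f : V -> W).

Definition ext2_free_map (g : {malg K[(V * V)%type]}) : ext2 W :=
  \sum_(p <- msupp g) g@_p *: wedge (f p.1) (f p.2).

Definition ext2_map (x : ext2 V) : ext2 W := lquot_lift ext2_free_map x.

End ExteriorSquareMap.

Section ExteriorSquareMapTheory.
Variables (K : fieldType) (V W : lmodType K) (f : {linear V -> W}).

Lemma ext2_free_mapEw (d : {fset V * V}) (g : {malg K[(V * V)%type]}) :
  (msupp g `<=` d)%fset ->
  ext2_free_map f g = \sum_(p <- d) g@_p *: wedge (f p.1) (f p.2).
Proof.
move=> gd; rewrite /ext2_free_map (big_fset_incl _ gd) //= => p _ Np.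
by rewrite (mcoeff_outdom Np) scale0r.
Qed.

Fact ext2_free_map_is_linear : linear (ext2_free_map f).
Proof.
move=> a g h; pose d := (msupp (a *: g + h) `|` msupp g `|` msupp h)%fset.
rewrite (@ext2_free_mapEw d (_ + _)) ?(@ext2_free_mapEw d g);
  rewrite ?(@ext2_free_mapEw d h).
- rewrite scaler_sumr -big_split /=; apply: eq_bigr => p _.
  by rewrite mcoeffD mcoeffZ scalerDl scalerA.
- exact: fsubsetUr.
- by rewrite /d -fsetUA fsetUCA fsubsetUl.
- by rewrite /d -fsetUA fsubsetUl.
Qed.
HB.instance Definition _ := GRing.isLinear.Build K _ _ _ (ext2_free_map f)
  ext2_free_map_is_linear.

Lemma ext2_free_map_gen v w :
  ext2_free_map f (ext2_gen v w) = wedge (f v) (f w).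
Proof.
rewrite (@ext2_free_mapEw [fset (v, w)]%fset) ?msuppU_le //.
by rewrite big_seq_fset1 mcoeffUU scale1r.
Qed.

Lemma ext2_map_class g :
  ext2_map f (lclass (@ext2_rel K V) g) = ext2_free_map f g.
Proof.
apply: (lquot_liftE (f := ext2_free_map f)).
move=> _ [a s t u|a s t u|u]; last by rewrite /= ext2_free_map_gen wedgevv.
- rewrite linearB linearP /= !ext2_free_map_gen.
  by rewrite [f (_ + _)]linearP wedgePl subrr.
- rewrite linearB linearP /= !ext2_free_map_gen.
  by rewrite [f (_ + _)]linearP wedgePr subrr.
Qed.

Lemma ext2_map_wedge v w : ext2_map f (wedge v w) = wedge (f v) (f w).
Proof. by rewrite /wedge ext2_map_class ext2_free_map_gen. Qed.

Fact ext2_map_is_linear : linear (ext2_map f).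
Proof.
move=> a x y; rewrite -[x]lreprK -[y]lreprK.
by rewrite -[a *: _ + _]linearP !ext2_map_class linearP.
Qed.
HB.instance Definition _ :=
  GRing.isLinear.Build K (ext2 V) (ext2 W) _ (ext2_map f) ext2_map_is_linear.

End ExteriorSquareMapTheory.

(* 'cV[R]_2 with rational scalars only. *)
Definition plane (R : realType) : Type := 'cV[R]_2.

Section Plane.
Variable R : realType.

HB.instance Definition _ := GRing.Zmodule.on (plane R).

Definition plane_scale (q : rat) (v : plane R) : plane R :=
  ratr q *: (v : 'cV[R]_2).

Fact plane_scaleA p q v : plane_scale p (plane_scale q v) = plane_scale (p * q) v.
Proof. by rewrite /plane_scale scalerA rmorphM. Qed.
Fact plane_scale1 : left_id 1 plane_scale.
Proof. by move=> v; rewrite /plane_scale rmorph1 scale1r. Qed.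
Fact plane_scaleDr : right_distributive plane_scale +%R.
Proof. by move=> q v w; rewrite /plane_scale scalerDr. Qed.
Fact plane_scaleDl v : {morph plane_scale^~ v : p q / p + q}.
Proof. by move=> p q; rewrite /plane_scale rmorphD scalerDl. Qed.

HB.instance Definition _ := GRing.Zmodule_isLmodule.Build rat (plane R)
  plane_scaleA plane_scale1 plane_scaleDr plane_scaleDl.

Definition plane_act (a : 'M[R]_2) (v : plane R) : plane R :=
  a *m (v : 'cV[R]_2).

Fact plane_act_is_linear a : linear (plane_act a).
Proof.
move=> q v w; rewrite /plane_act mulmxDr; congr (_ + _).
exact: (esym (scalemxAr _ _ _)).
Qed.
HB.instance Definition _ a :=
  GRing.isLinear.Build rat (plane R) (plane R) _ (plane_act a)
    (plane_act_is_linear a).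

Definition plane_det (v w : plane R) : R :=
  \det (row_mx (v : 'cV[R]_2) (w : 'cV[R]_2) : 'M[R]_2).

(* Side number i of triangle t runs from corner i to corner i + 1, indices
   modulo 3. *)
Definition side (T : Type) (corner : T -> 'I_3 -> plane R) (d : T * 'I_3) :
    plane R :=
  corner d.1 (d.2 + 1) - corner d.1 d.2.

End Plane.

(* A translation surface, given by an edge-to-edge decomposition into
   Euclidean triangles: positively oriented triangles of the plane, each side
   of which is glued by a translation to a side bounding its triangle from the
   opposite direction. Since sides are nonzero, glue has no fixed point. All
   cone points are among the vertices. *)
Record translation_surface (R : realType) := TranslationSurface {
  face : finType;
  corner : face -> 'I_3 -> plane R;
  glue : face * 'I_3 -> face * 'I_3;
  face_ccw : forall t,
    0 < plane_det (side corner (t, 0)) (side corner (t, 1));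
  glueK : involutive glue;
  glue_side : forall d, side corner (glue d) = - side corner d;
  face_gt0 : (0 < #|face|)%N;
  face_connected : forall t u,
    connect (fun t u => [exists i, (glue (t, i)).1 == u]) t u
}.

Section TranslationSurface.
Variables (R : realType) (S : translation_surface R).

(* A dart (t, i) is side i of triangle t with its counterclockwise direction;
   glue d is the same edge of the surface in the opposite direction. *)
Definition dart : finType := (face S * 'I_3)%type.

Definition vec (d : dart) : plane R := side (@corner R S) d.

Definition Jinvariant : ext2 (plane R) :=
  \sum_(t : face S) wedge (vec (t, 0)) (vec (t, 1)).

(* The next dart counterclockwise with the same starting vertex; the vertices
   of the surface are the orbits of turn. *)
Definition turn (d : dart) : dart := glue (d.1, d.2 - 1).

Lemma turn_inj : injective turn.
Proof.
move=> [t i] [u j] /(can_inj (@glueK _ S)) /= ij.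
by congr pair; [exact: (congr1 fst ij) | exact: (addIr _ (congr1 snd ij))].
Qed.

Definition source (d : dart) : dart := froot turn d.
Definition target (d : dart) : dart := source (glue d).

(* H_1 is computed from the cell structure: 1-chains are combinations of
   darts, where glue d is to be identified with - d. *)
Definition chain : Type := {ffun dart -> rat^o}.
HB.instance Definition _ := GRing.Lmodule.on chain.
HB.instance Definition _ := Vector.on chain.

Definition edge (d : dart) : chain := [ffun e => (e == d)%:R].

Definition boundary (z : chain) : chain :=
  [ffun v => \sum_(d | target d == v) z d - \sum_(d | source d == v) z d].

Fact boundary_is_linear : linear boundary.
Proof.
move=> q z w; apply/ffunP => v; rewrite !ffunE.
have lin (P : pred dart) : \sum_(d | P d) (q *: z + w) d =
    q *: \sum_(d | P d) z d + \sum_(d | P d) w d.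
  by rewrite scaler_sumr -big_split; apply: eq_bigr => d _; rewrite !ffunE.
by rewrite !lin scalerBr opprD !addrA; congr (_ + _); rewrite -!addrA;
   congr (_ + _); rewrite addrC.
Qed.
HB.instance Definition _ :=
  GRing.isLinear.Build rat chain chain _ boundary boundary_is_linear.

Definition cycles : {vspace chain} := lker (linfun boundary).

Inductive null_cycle : set (subvs_of cycles) :=
| NullEdge z d : vsval z = edge d + edge (glue d) -> null_cycle z
| NullFace z t : vsval z = \sum_i edge (t, i) -> null_cycle z.

Definition H1 : Type := lquot null_cycle.
HB.instance Definition _ := GRing.Lmodule.on H1.

Definition chain_hol (z : chain) : plane R := \sum_d z d *: vec d.

Definition hol (x : H1) : plane R :=
  lquot_lift (fun z : subvs_of cycles => chain_hol (vsval z)) x.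

(* Algebraic number of crossings of two edge cycles z and w at the vertex v.
   With d_0, ..., d_(k-1) the darts leaving v in counterclockwise order, and
   a_i, b_i the net flows of z and w out of v along d_i, it is half the sum
   over i < j of a_i b_j - a_j b_i; as the a_i and the b_i sum to 0, it depends
   only on the cyclic order. A transverse crossing of w from the right to the
   left of z counts for 1; where z and w share a path of edges, each end of
   the path contributes 1/2 or -1/2 according to the side on which w joins or
   leaves z. *)
Definition outflow (z : chain) (d : dart) : rat := z d - z (glue d).

Definition crossing (z w : chain) (v : dart) : rat :=
  2^-1 * \sum_(j < order turn v) \sum_(i < j)
    (outflow z (iter i turn v) * outflow w (iter j turn v)
     - outflow z (iter j turn v) * outflow w (iter i turn v)).

Definition chain_intersection (z w : chain) : rat :=
  \sum_(v | froots turn v) crossing z w v.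

(* Independent of the representing cycles, by intersection_class below. *)
Definition intersection (x y : H1) : rat :=
  chain_intersection (vsval (lrepr x)) (vsval (lrepr y)).

End TranslationSurface.

Definition Iso (R : realType) (x : ext2 (plane R)) : set 'M[R]_2 :=
  [set a | \det a = 1 /\ ext2_map (plane_act a) x = x].

Definition Aff_H1 (R : realType) (S : translation_surface R) : set 'M[R]_2 :=
  [set a | \det a = 1 /\
    exists A : {linear H1 S -> H1 S},
      [/\ bijective A,
          forall x y, intersection (A x) (A y) = intersection x y
        & forall x, hol (A x) = plane_act a (hol x)]].

Section WellDefined.
Variables (R : realType) (S : translation_surface R).
Implicit Types (z w : chain S) (d v : dart S).

Fact chain_hol_is_linear : linear (@chain_hol R S).
Proof.
move=> q z w; rewrite /chain_hol scaler_sumr -big_split.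
by apply: eq_bigr => d _; rewrite !ffunE scalerDl scalerA.
Qed.
HB.instance Definition _ :=
  GRing.isLinear.Build rat (chain S) (plane R) _ (@chain_hol R S)
    chain_hol_is_linear.

Lemma chain_hol_edge d : chain_hol (edge d) = vec d.
Proof.
rewrite /chain_hol (bigD1 d) //= ffunE eqxx scale1r big1 ?addr0 // => e ed.
by rewrite ffunE (negPf ed) scale0r.
Qed.

Lemma hol_class (z : subvs_of (cycles S)) :
  hol (lclass (@null_cycle R S) z) = chain_hol (vsval z).
Proof.
apply: (lquot_liftE (f := @chain_hol R S \o vsval)).
move=> y [{}y d|{}y t] /= ->; first by rewrite linearD /= !chain_hol_edge
  [vec (glue d)]glue_side subrr.
rewrite linear_sum /=; under eq_bigr do rewrite chain_hol_edge.
rewrite /vec /side /= sumrB; apply/eqP; rewrite subr_eq0; apply/eqP.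
by rewrite [RHS](reindex_inj (addIr 1)).
Qed.

Fact hol_is_linear : linear (@hol R S).
Proof.
move=> q x y; rewrite -[x]lreprK -[y]lreprK.
rewrite -[q *: _ + _]linearP !hol_class.
exact: (linearP (@chain_hol R S \o vsval)).
Qed.
HB.instance Definition _ :=
  GRing.isLinear.Build rat (H1 S) (plane R) _ (@hol R S) hol_is_linear.

Lemma outflowP q z w d : outflow (q *: z + w) d = q * outflow z d + outflow w d.
Proof. by rewrite /outflow !ffunE mulrBr opprD addrACA. Qed.

Lemma outflow_glue z d : outflow z (glue d) = - outflow z d.
Proof. by rewrite /outflow glueK opprB. Qed.

Lemma crossingC z w v : crossing w z v = - crossing z w v.
Proof.
rewrite /crossing -mulrN -sumrN; congr (_ * _); apply: eq_bigr => j _.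
rewrite -sumrN; apply: eq_bigr => i _; rewrite opprB.
by congr (_ - _); rewrite mulrC.
Qed.

Lemma chain_intersectionC z w :
  chain_intersection w z = - chain_intersection z w.
Proof.
by rewrite /chain_intersection -sumrN; apply: eq_bigr => v _; rewrite crossingC.
Qed.

Fact chain_intersection_is_linear z :
  linear (chain_intersection z : chain S -> rat^o).
Proof.
move=> q w u; rewrite /chain_intersection scaler_sumr -big_split.
apply: eq_bigr => v _; rewrite /crossing /= -[RHS]/(q * _ + _) mulrCA -mulrDr.
congr (_ * _); rewrite mulr_sumr -big_split; apply: eq_bigr => j _.
rewrite mulr_sumr -big_split; apply: eq_bigr => i _ /=.
by rewrite !outflowP; ring.
Qed.
HB.instance Definition _ z :=
  GRing.isLinear.Build rat (chain S) rat^o _ (chain_intersection z)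
    (chain_intersection_is_linear z).

Lemma turn_connect_sym : connect_sym (frel (@turn R S)).
Proof. exact/fconnect_sym/turn_inj. Qed.

Lemma sum_orbit (F : dart S -> rat) v : froots (@turn R S) v ->
  \sum_(d | source d == v) F d = \sum_(i < order (@turn R S) v)
    F (iter i (@turn R S) v).
Proof.
move=> /eqP rv.
transitivity (\sum_(d <- orbit (@turn R S) v) F d).
  rewrite (big_uniq _ (orbit_uniq _ _)); apply: eq_bigl => d /=.
  rewrite -fconnect_orbit -[in LHS]rv /source root_connect.
    by rewrite turn_connect_sym.
  exact: turn_connect_sym.
rewrite /orbit; move: {rv} (order (@turn R S) v) => n; elim: n v => [|n IHn] v /=.
  by rewrite big_nil big_ord0.
rewrite big_cons big_ord_recl IHn; congr (_ + _).
by apply: eq_bigr => i _; rewrite -iterSr.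
Qed.

Lemma cycle_outflow z v : z \in cycles S -> \sum_(d | source d == v) outflow z d = 0.
Proof.
rewrite memv_ker lfunE /= => /eqP/ffunP/(_ v); rewrite !ffunE => /eqP.
rewrite subr_eq0 => /eqP zv; rewrite sumrB -zv (reindex_inj (can_inj (@glueK _ S))).
under eq_bigl do rewrite /target glueK.
by rewrite subrr.
Qed.

Lemma crossing_telescope (a P : nat -> rat) k :
  \sum_(j < k) \sum_(i < j)
    (a i * (P j.+1 - P j) - a j * (P i.+1 - P i)) =
  \sum_(i < k) a i * (P k - P i.+1 - P i + P 0).
Proof.
elim: k => [|k IHk]; first by rewrite !big_ord0.
rewrite !big_ord_recr /= IHk sumrB -!mulr_suml -mulr_sumr.
have -> : \sum_(i < k) (P i.+1 - P i) = P k - P 0.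
  by rewrite -(big_mkord xpredT (fun i => P i.+1 - P i)) telescope_sumr.
rewrite mulr_suml addrA -big_split /=; congr (_ + _).
  by apply: eq_bigr => i _; ring.
by ring.
Qed.

Lemma outflow_edge d e : outflow (edge d) e = (e == d)%:R - (e == glue d)%:R.
Proof. by rewrite /outflow !ffunE (can2_eq (@glueK _ S) (@glueK _ S)). Qed.

Lemma outflow_face t d :
  outflow (\sum_i edge (t, i)) d = (d.1 == t)%:R - ((glue d).1 == t)%:R.
Proof.
have facet e : (\sum_i edge (t, i) : chain S) e = (e.1 == t)%:R.
  rewrite sum_ffunE; case: e => u j /=.
  rewrite (bigD1 j) //= ffunE xpair_eqE eqxx andbT big1 ?addr0 // => i ij.
  by rewrite ffunE xpair_eqE [j == i]eq_sym (negPf ij) andbF.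
by rewrite /outflow !facet.
Qed.

Lemma chain_intersection_edge z d :
  chain_intersection z (edge d + edge (glue d)) = 0.
Proof.
rewrite /chain_intersection big1 // => v _.
rewrite /crossing big1 ?mulr0 // => j _; rewrite big1 // => i _.
have out0 e : outflow (edge d + edge (glue d)) e = 0.
  rewrite -[edge d]scale1r outflowP !outflow_edge glueK mul1r.
  by rewrite addrC subrKA subrr.
by rewrite !out0 !mulr0 subrr.
Qed.

Lemma chain_intersection_face z t : z \in cycles S ->
  chain_intersection z (\sum_i edge (t, i)) = 0.
Proof.
move=> Zz.
pose G d := outflow z d * ((d.1 == t)%:R + ((glue d).1 == t)%:R).
have cG v : froots (@turn R S) v ->
    crossing z (\sum_i edge (t, i)) v = - 2^-1 * \sum_(d | source d == v) G d.
  move=> rv; pose k := order (@turn R S) v.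
  pose a i := outflow z (iter i (@turn R S) v).
  pose P i : rat := ((glue (iter i (@turn R S) v)).1 == t)%:R.
  have PS i : P i.+1 = ((iter i (@turn R S) v).1 == t)%:R.
    by rewrite /P iterS [turn (iter _ _ _)]/turn glueK.
  have Pk : P k = P 0 by rewrite /P /k iter_order //; exact: turn_inj.
  rewrite /crossing.
  under eq_bigr do under eq_bigr do rewrite !outflow_face -!PS -/(P _) -/(a _).
  under eq_bigr do under eq_bigr do rewrite -/(P _) -/(a _).
  rewrite (crossing_telescope a P) -/k Pk.
  have a0 : \sum_(i < k) a i = 0 by rewrite -(sum_orbit (outflow z)) ?cycle_outflow.
  transitivity (2^-1 * (\sum_(i < k) a i * (2 * P 0)
                        - \sum_(i < k) a i * (P i.+1 + P i))).
    by rewrite -sumrB; congr (_ * _); apply: eq_bigr => i _; ring.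
  rewrite -mulr_suml a0 mul0r sub0r mulrN mulNr; congr (- (_ * _)).
  rewrite (sum_orbit G rv); apply: eq_bigr => i _.
  by rewrite /G PS.
rewrite /chain_intersection (eq_bigr _ cG) -mulr_sumr.
have <- : \sum_d G d =
    \sum_(v | froots (@turn R S) v) \sum_(d | source d == v) G d.
  apply: partition_big => d _.
  by rewrite /source roots_root //; exact: turn_connect_sym.
have: \sum_d G d = - \sum_d G d.
  rewrite [LHS](reindex_inj (can_inj (@glueK _ S))) -sumrN.
  by apply: eq_bigr => d _; rewrite /G outflow_glue glueK mulNr addrC.
by move/eqP; rewrite -addr_eq0 -mulr2n mulrn_eq0 /= => /eqP ->; rewrite mulr0.
Qed.

Lemma intersection_class (z w : subvs_of (cycles S)) :
  intersection (lclass (@null_cycle R S) z) (lclass (@null_cycle R S) w) =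
  chain_intersection (vsval z) (vsval w).
Proof.
have killr (y u : subvs_of (cycles S)) : null_cycle u ->
    chain_intersection (vsval y) (vsval u) = 0.
  case=> x e ->; first exact: chain_intersection_edge.
  exact/chain_intersection_face/subvsP.
have Er (y u : subvs_of (cycles S)) : chain_intersection (vsval y)
    (vsval (lrepr (lclass (@null_cycle R S) u))) =
    chain_intersection (vsval y) (vsval u).
  pose f : {linear subvs_of (cycles S) -> rat^o} :=
    chain_intersection (vsval y) \o vsval.
  exact: (lquot_liftE (f := f) u (killr y)).
rewrite /intersection Er chain_intersectionC Er.
by rewrite -chain_intersectionC.
Qed.

End WellDefined.

(* Main.v *)
Require Import Defs.
From mathcomp Require Import all_boot all_algebra.
From mathcomp Require Import reals.
From mathcomp Require Import all_order ring.

(* Take the 4 x 1 rectangle, cut both horizontal sides into segments of lengths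
   s, 4 - 2s, s, and glue the bottom segments to the top ones in reversed order
   and the left side to the right one. All vertices are identified, the
   holonomies are spanned over Q by (s, 0), (4 - 2s, 0), (0, 1), and the
   J-invariant is 8 (e_1 /\ e_2). So the rotation by a right angle fixes J. For
   irrational s it does not come from homology, as it sends the holonomy (s, 0)
   to (0, s), while all holonomies have a rational second coordinate. *)

Set Implicit Arguments.
Unset Strict Implicit.
Unset Printing Implicit Defensive.

Import Order.TTheory GRing.Theory Num.Theory.

Local Open Scope ring_scope.

(** * Plane vectors and the right-angle rotation in coordinates *)

Section PlaneVectors.
Variable R : realType.

Definition plane_vec (x y : R) : plane R := \col_i (if i == 0 then x else y).

Lemma plane_vecD x y x' y' :
  plane_vec x y + plane_vec x' y' = plane_vec (x + x') (y + y').
Proof. by apply/matrixP => i j; rewrite !mxE; case: ifP. Qed.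

Lemma plane_vecN x y : - plane_vec x y = plane_vec (- x) (- y).
Proof. by apply/matrixP => i j; rewrite !mxE; case: ifP. Qed.

Lemma det_mx2 (A : 'M[R]_2) : \det A = A 0 0 * A 1 1 - A 0 1 * A 1 0.
Proof.
rewrite (expand_det_row _ 0) big_ord_recl big_ord1 /cofactor !det_mx11 !mxE /=.
rewrite expr0 expr1 mul1r mulN1r mulrN.
by congr (_ * A _ _ - A _ _ * A _ _); apply: val_inj.
Qed.

Lemma plane_det_vec x y x' y' :
  plane_det (plane_vec x y) (plane_vec x' y') = x * y' - x' * y.
Proof.
rewrite /plane_det det_mx2.
have col0 (v w : 'cV[R]_2) i : row_mx v w i (0 : 'I_2) = v i 0.
  by rewrite -(row_mxEl v w i 0); congr (row_mx v w i _); apply: val_inj.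
have col1 (v w : 'cV[R]_2) i : row_mx v w i (1 : 'I_2) = w i 0.
  by rewrite -(row_mxEr v w i 0); congr (row_mx v w i _); apply: val_inj.
by rewrite !col0 !col1 !mxE.
Qed.

Definition quarter_turn : 'M[R]_2 :=
  \matrix_(i, j) (if i == 0 then (if j == 0 then 0 else -1)
                  else (if j == 0 then 1 else 0)).

Lemma det_quarter_turn : \det quarter_turn = 1.
Proof. by rewrite det_mx2 !mxE /= mul0r mulN1r sub0r opprK. Qed.

Lemma quarter_turn_vec x y :
  plane_act quarter_turn (plane_vec x y) = plane_vec (- y) x.
Proof.
apply/matrixP => i j; rewrite !mxE big_ord_recl big_ord1 !mxE /=.
by case: ifP => _; rewrite ?mul0r ?mul1r ?add0r ?addr0 ?mulN1r.
Qed.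

End PlaneVectors.

(** * Calculation rules in the exterior square *)

Section Wedge.
Variables (K : fieldType) (V : lmodType K).
Implicit Types u v w : V.

Lemma wedgeDl u v w : wedge (u + v) w = wedge u w + wedge v w.
Proof. by rewrite -[u]scale1r wedgePl !scale1r. Qed.

Lemma wedgeDr u v w : wedge u (v + w) = wedge u v + wedge u w.
Proof. by rewrite -[v]scale1r wedgePr !scale1r. Qed.

Lemma wedgeC u v : wedge u v = - wedge v u.
Proof.
apply/eqP; rewrite -addr_eq0; apply/eqP.
have := wedgevv (u + v).
by rewrite wedgeDl !wedgeDr !wedgevv add0r addr0.
Qed.

Lemma wedge0l w : wedge 0 w = 0.
Proof. by apply: (addrI (wedge 0 w)); rewrite -wedgeDl !addr0. Qed.

Lemma wedgeNl v w : wedge (- v) w = - wedge v w.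
Proof. by apply/eqP; rewrite -addr_eq0 -wedgeDl addNr wedge0l. Qed.

Lemma wedgeNr v w : wedge v (- w) = - wedge v w.
Proof. by rewrite wedgeC wedgeNl -wedgeC. Qed.

Lemma wedgeZl a v w : wedge (a *: v) w = a *: wedge v w.
Proof. by rewrite -[a *: v]addr0 wedgePl wedge0l addr0. Qed.

Lemma wedge_suml (I : finType) (F : I -> V) w :
  wedge (\sum_i F i) w = \sum_i wedge (F i) w.
Proof.
exact: (big_morph (fun u => wedge u w) (fun u v => wedgeDl u v w) (wedge0l w)).
Qed.

End Wedge.

(** In [numq q ^+ 2 = 2 * denq q ^+ 2] the exponent of 2 would be even on the left and odd on the
    right. *)
Lemma rat_sqr_neq2 (q : rat) : q ^+ 2 != 2.
Proof.
apply/eqP => q2.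
have d0 : (0 < `|denq q|)%N by rewrite absz_gt0 denq_neq0.
have /(congr1 absz): numq q ^+ 2 = 2 * denq q ^+ 2.
  apply: (@intr_inj rat); rewrite [in RHS]intrM !rmorphXn /=.
  have -> : 2%:~R = q ^+ 2 by rewrite q2.
  by rewrite -exprMn -numqE.
rewrite abszM !abszX => /(congr1 (fun n => odd (logn 2 n))).
by rewrite lognM ?expn_gt0 ?d0 // !lognX oddD !oddM.
Qed.

(** * The surface glued from six triangles, and its J-invariant *)

Section RectangleSurface.
Variables (R : realType) (s : R).
Hypotheses (s_gt0 : 0 < s) (s_lt2 : s < 2).

(* Columns 0, 1, 2 of the rectangle are cut by the diagonal from the upper left
   to the lower right corner; (false, i) is the lower left triangle of column i
   and (true, i) the upper right one, which is its image under v |-> - v up to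
   a translation. Side 0 is horizontal, side 1 the diagonal, side 2 vertical. *)
Definition rface : finType := (bool * 'I_3)%type.

(** The widths add up to 4 for every [s], which makes [s] cancel in the J-invariant. *)
Definition width (i : 'I_3) : R := if i == 1 then 4 - (s + s) else s.

(** Each triangle has its right angle at the origin instead of its place in the rectangle, as gluing
    by translations only sees side vectors. *)
Definition rcorner (t : rface) (k : 'I_3) : plane R :=
  let v := plane_vec (if k == 1 then width t.2 else 0) (if k == 2 then 1 else 0) in
  if t.1 then - v else v.

(** Addition in ['I_3] is modulo 3, so the vertical case also glues the left side of the rectangle
    to the right one. *)
Definition rglue (d : rface * 'I_3) : rface * 'I_3 :=
  let: (b, i, k) := d in
  if k == 0 then (~~ b, rev_ord i, k)
  else if k == 1 then (~~ b, i, k)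
  else (~~ b, if b then i + 1 else i - 1, k).

Lemma width_gt0 i : 0 < width i.
Proof.
rewrite /width; case: ifP => // _; rewrite subr_gt0.
by rewrite (_ : 4 = 2 + 2) ?ltrD // -natrD.
Qed.

Lemma width_rev i : width (rev_ord i) = width i.
Proof. by case: i => [[|[|[|]]] ?]. Qed.

Lemma rside (b : bool) (i k : 'I_3) :
  side rcorner (b, i, k) =
  let v := if k == 0 then plane_vec (width i) 0
           else if k == 1 then plane_vec (- width i) 1
           else plane_vec 0 (- 1) in
  if b then - v else v.
Proof.
rewrite /side /rcorner /=.
have -> (u w : plane R) : (if b then - u else u) - (if b then - w else w) =
    if b then - (u - w) else u - w.
  by case: b => //; rewrite opprD.
congr (if b then - _ else _); rewrite plane_vecN plane_vecD;
by case: k => [[|[|[|]]] ?] //=; congr plane_vec;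
  rewrite ?subr0 ?sub0r ?oppr0 ?addr0.
Qed.

Lemma rface_ccw t :
  0 < plane_det (side rcorner (t, 0)) (side rcorner (t, 1)).
Proof.
case: t => b i; rewrite !rside /=.
by case: b; rewrite ?plane_vecN plane_det_vec ?oppr0 ?mulr0 ?subr0 ?mulrNN ?mulr1
  width_gt0.
Qed.

Lemma rglueK : involutive rglue.
Proof.
move=> [[b i] k]; case: k => [[|[|[|]]] ?] //=; rewrite negbK ?rev_ordK //.
by case: b; rewrite /= ?addrK ?subrK.
Qed.

Lemma rglue_side d : side rcorner (rglue d) = - side rcorner d.
Proof.
case: d => [[b i] k] /=.
by case: ifP => k0; [|case: ifP => k1]; rewrite !rside /= k0 ?k1 ?width_rev;
  case: b; rewrite /= ?opprK.
Qed.

Lemma rface_gt0 : (0 < #|rface|)%N.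
Proof. by rewrite card_prod card_bool card_ord. Qed.

(** Crossing diagonals and vertical sides in turn visits all six triangles in one cycle. *)
Definition next_face (t : rface) : rface :=
  (~~ t.1, if t.1 then t.2 + 1 else t.2).

Lemma next_face_inj : injective next_face.
Proof.
by move=> [b i] [b' i'] [/negb_inj ->]; case: b' => [/addIr|] ->.
Qed.

Lemma rface_connected t u :
  connect (fun t u => [exists i, (rglue (t, i)).1 == u]) t u.
Proof.
suff /connect_sub : forall x y, frel next_face x y ->
    connect (fun t u => [exists i, (rglue (t, i)).1 == u]) x y.
  apply; have to v : fconnect next_face (false, 0) v.
    (* The walk is at [(false, i)] after 2i steps and at [(true, i)] after 2i + 1. *)
    suff {1}-> : v = iter (2 * v.2 + v.1) next_face (false, 0).
      exact: fconnect_iter.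
    case: v => [[] [[|[|[|]]] ?]] //=; congr pair; exact: val_inj.
  by apply: connect_trans (to u); rewrite fconnect_sym //; exact: next_face_inj.
move=> [b i] _ /eqP <-; apply/connect1/existsP.
by exists (if b then 2 else 1); case: b.
Qed.

Definition rect_surface : translation_surface R :=
  TranslationSurface rface_ccw rglueK rglue_side rface_gt0 rface_connected.

Local Notation S := rect_surface.

(** Up to sign, the diagonal is (0, 1) modulo the horizontal side. Both triangles of a column give
    the same wedge, so the first factors add up to twice the total width 4. *)
Lemma rect_Jinvariant :
  Jinvariant S = 8 *: wedge (plane_vec 1 0) (plane_vec 0 1).
Proof.
have rwedge (b : bool) (i : 'I_3) :
    wedge (@vec _ S (b, i, 0)) (@vec _ S (b, i, 1)) =
    wedge (plane_vec (width i) 0) (plane_vec 0 1).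
  rewrite /vec !rside /=.
  transitivity (wedge (plane_vec (width i) 0) (plane_vec (- width i) 1)).
    by case: b; [rewrite wedgeNl wedgeNr opprK | reflexivity].
  rewrite (_ : plane_vec (- width i) 1 =
    - plane_vec (width i) 0 + plane_vec 0 1); last first.
    by rewrite plane_vecN plane_vecD addr0 oppr0 add0r.
  by rewrite wedgeDr wedgeNr wedgevv oppr0 add0r.
transitivity (\sum_(t : rface) wedge (plane_vec (width t.2) 0) (plane_vec 0 1)).
  by apply: eq_bigr => -[b i] _; exact: rwedge.
rewrite -wedge_suml -wedgeZl; apply: (congr1 (fun u => wedge u _)).
rewrite -(pair_bigA _ (fun b i => plane_vec (width i) 0)) big_bool /=.
rewrite !big_ord_recl big_ord0 addr0 /width /= !plane_vecD !addr0.
by apply/matrixP => i j; rewrite !mxE rmorph_nat; case: ifP => _; ring.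
Qed.

(** * Holonomies of the surface *)

Lemma rect_source_bottom (d : dart S) :
  d = (false, 0, 0) -> target d = source d.
Proof.
move=> ->; apply/esym/(fingraph.rootP (@turn_connect_sym R S)).
(* The number 9 comes from following the gluings around the vertex; no real number enters this
   computation. *)
suff -> : glue ((false, 0, 0) : dart S) = iter 9 (@turn R S) (false, 0, 0).
  exact: fconnect_iter.
by apply/eqP; vm_compute.
Qed.

Lemma rect_hol_bottom : exists x : H1 S, hol x = plane_vec s 0.
Proof.
pose d : dart S := (false, 0, 0).
have Cd : edge d \in cycles S.
  rewrite memv_ker lfunE; apply/eqP/ffunP => v; rewrite !ffunE.
  have sum1 (P : pred (dart S)) : \sum_(e | P e) edge d e = (P d)%:R.
    rewrite big_mkcond (bigD1 d) //= ffunE eqxx big1 ?addr0; last first.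
      by move=> e ed; rewrite ffunE (negPf ed) if_same.
    by case: (P d).
  by rewrite !sum1 rect_source_bottom // subrr.
exists (lclass (@null_cycle R S) (vsproj (cycles S) (edge d))).
by rewrite hol_class vsprojK // chain_hol_edge /vec rside.
Qed.

Definition rational_height (v : plane R) :=
  exists q : rat, (v : 'cV[R]_2) 1 0 = ratr q.

Lemma rational_height_vec (d : dart S) : rational_height (vec d).
Proof.
case: d => [[b i] k].
exists (let q := if k == 0 then 0 else if k == 1 then 1 else -1 in
        if b then - q else q).
rewrite /vec rside.
by case: b; case: (k == 0); case: (k == 1);
  rewrite /= !mxE /= ?rmorphN ?rmorphN1 ?rmorph1 ?rmorph0.
Qed.

(** Sides have height 0, 1 or -1, and chains have rational coefficients. *)
Lemma rational_height_hol (x : H1 S) : rational_height (hol x).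
Proof.
rewrite -[x]lreprK hol_class /chain_hol.
apply: big_ind => [|u v [p up] [q vq]|d _].
- by exists 0; rewrite mxE rmorph0.
- by exists (p + q); rewrite mxE up vq rmorphD.
- have [q dq] := rational_height_vec d.
  by exists (vsval (lrepr x) d * q); rewrite mxE dq rmorphM.
Qed.

(** The rotation sends e_1 to e_2 and e_2 to -e_1, and e_2 /\ (-e_1) = e_1 /\ e_2. *)
Lemma quarter_turn_Iso : Iso (Jinvariant S) (quarter_turn R).
Proof.
split; first exact: det_quarter_turn.
rewrite rect_Jinvariant; set w := wedge _ _.
suff fixw : ext2_map (plane_act (quarter_turn R)) w = w.
  by rewrite -[in RHS]fixw; exact: linearZ.
rewrite ext2_map_wedge /= !quarter_turn_vec oppr0.
have -> : plane_vec (- 1) 0 = - plane_vec 1 0 :> plane R.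
  by rewrite plane_vecN oppr0.
by rewrite wedgeNr -wedgeC.
Qed.

Lemma quarter_turn_Aff_H1 :
  (forall q : rat, s <> ratr q) -> ~ Aff_H1 S (quarter_turn R).
Proof.
move=> s_irr [_ [A [_ _ holA]]].
have [x xs] := rect_hol_bottom; have [q] := rational_height_hol (A x).
by rewrite holA xs quarter_turn_vec mxE => /s_irr.
Qed.

End RectangleSurface.

Theorem corollary11p2 (R : realType) :
  exists S : translation_surface R, Iso (Jinvariant S) <> Aff_H1 S.
Proof.
(* The choice s = sqrt 2 is irrational and keeps the middle width 4 - 2s positive. *)
have s_gt0 : 0 < Num.sqrt 2 :> R by rewrite sqrtr_gt0.
have s2 : Num.sqrt 2 ^+ 2 = 2 :> R by rewrite sqr_sqrtr.
have s_lt2 : Num.sqrt 2 < 2 :> R.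
  by rewrite -(ltr_pXn2r (n := 2)) ?nnegrE ?ltW // s2 -natrX ltr_nat.
exists (rect_surface s_gt0 s_lt2) => E.
have := quarter_turn_Iso s_gt0 s_lt2; rewrite E.
apply: quarter_turn_Aff_H1 => q sq; move: s2; rewrite sq.
(* Injectivity of [ratr] brings the equation back to the rationals. *)
rewrite -rmorphXn -(rmorph_nat (@ratr R) 2) => /fmorph_inj/eqP.
exact/negP/rat_sqr_neq2.
Qed.
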